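(* Let $d\ge 2$ be an integer. Let $H$ be a connected graph with maximum degree $d$ and $N$ vertices, where $N>d^{d^{d^d}}$, and let $U\subseteq V(H)$. Then there exists a graph $G$ such that $N\le|V(G)|\le 2^{d^{21d+20}}N$, the maximum degree of $G$ is at most $d\,2^{d^{21d+20}}$, and there are at least $2^{|V(G)|/2^{d^{21d+20}}}$ sets $S\subseteq V(G)$ such that $G[S]$ is a maximal $U$-clique prescribed blow-up of $H$.
   Context: All graphs are finite and simple. With $V(H)=\{1,\dots,k\}$, a $U$-clique prescribed blow-up of $H$ is a graph whose vertex set is partitioned into nonempty sets $V_1\sqcup\dots\sqcup V_k$ such that $V_i$ is complete to $V_j$ whenever $ij\in E(H)$ and $V_i$ is a clique for each $i\in U$. For $S\subseteq V(G)$, $G[S]$ is a maximal such blow-up if $G[S]$ is one and there is no $S'$ with $S\subsetneq S'\subseteq V(G)$ such that $G[S']$ is one. *)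

(* Defs.v *)
From mathcomp Require Import all_boot all_order all_algebra.
From mathcomp Require Import reals exp.

Set Implicit Arguments.
Unset Strict Implicit.
Unset Printing Implicit Defensive.

Record sgraph := SGraph {
  vertex :> finType;
  adj : rel vertex;
  adj_sym : symmetric adj;
  adj_irr : irreflexive adj }.

Definition degree (G : sgraph) (x : G) : nat := #|[set y | adj x y]|.

Definition max_degree (G : sgraph) : nat := \max_(x : G) degree x.

Definition connected (G : sgraph) : Prop :=
  forall x y : G, connect (@adj G) x y.

Section Induced.
Variables (G : sgraph) (S : {set G}).

Definition induced_adj : rel {x : G | x \in S} :=
  fun x y => adj (val x) (val y).

Fact induced_sym : symmetric induced_adj.
Proof. by move=> x y; apply: adj_sym. Qed.

Fact induced_irr : irreflexive induced_adj.
Proof. by move=> x; apply: adj_irr. Qed.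

Definition induced : sgraph := SGraph induced_sym induced_irr.
End Induced.

Definition complete_to (G : sgraph) (A B : {set G}) : bool :=
  [forall x in A, forall y in B, adj x y].

Definition clique (G : sgraph) (A : {set G}) : bool :=
  [forall x in A, forall y in A, (x != y) ==> adj x y].

(* Nothing is required between V i and V j when ij is a non-edge of H, nor
   inside V i when i is not in U. *)
Definition blowup_parts (H : sgraph) (U : {set H}) (K : sgraph)
    (V : {ffun H -> {set K}}) : bool :=
  [&& \bigcup_(i : H) V i == [set: K],
      [forall i : H, V i != set0],
      [forall i : H, forall j : H, (i != j) ==> [disjoint V i & V j]],
      [forall i : H, forall j : H, adj i j ==> complete_to (V i) (V j)] &
      [forall i in U, clique (V i)]].

Definition clique_blowup (H : sgraph) (U : {set H}) (K : sgraph) : bool :=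
  [exists V : {ffun H -> {set K}}, blowup_parts U V].

Definition maximal_blowups (H : sgraph) (U : {set H}) (G : sgraph) :
    {set {set G}} :=
  [set S : {set G} | maxset (fun S' => clique_blowup U (induced S')) S].

(* Main.v *)
(* A blow-up S of H is a map f from S onto V(H) such that x and y are adjacent
   whenever f x and f y are. Let delta be a degree for which the vertices of
   degree < delta are rare compared with those of degree delta. Choose many
   gadgets (small vertex sets) far apart in H and let G consist of H with a
   second copy of every gadget, the two copies not being joined. Choosing one
   copy of each gadget gives 2^t induced copies of H, each inside a maximal
   blow-up. A blow-up containing both copies of only z gadgets contains at most
   2^z of these copies of H, so it suffices that z <= t/2 for every blow-up S.
   Up to an error governed by the vertices of degree < delta:
   - if many vertices of degree delta have a neighbour of degree delta, take
     such edges as gadgets. Every additional vertex of S costs at least delta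
     edges in a blow-up, but doubling a gadget adds two vertices and only
     2 delta - 1 edges;
   - otherwise a gadget is a vertex v with all its neighbours of degree delta.
     The number of vertices with a neighbour of degree delta cannot be larger
     in S than in H, but doubling a gadget adds the second copy of v. *)
Require Import Defs.
From mathcomp Require Import all_boot all_order all_algebra.
From mathcomp Require Import reals exp.
From mathcomp Require Import zify.

Set Implicit Arguments.
Unset Strict Implicit.
Unset Printing Implicit Defensive.

(** * Neighbourhoods, packing and counting *)

Definition nbrs (G : sgraph) (x : G) : {set G} := [set y | adj x y].

Lemma degree_leq (G : sgraph) (m : nat) (x : G) :
  max_degree G <= m -> #|nbrs x| <= m.
Proof. by apply: leq_trans; exact: (@leq_bigmax _ (@degree G)). Qed.

Lemma connected_nbr (G : sgraph) (x : G) :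
  connected G -> 1 < #|G| -> exists y, adj x y.
Proof.
move=> cG G2; have /card_gt1P[u [v [_ _ uv]]] : 1 < #|[set: G]| by rewrite cardsT.
have [y yx] : exists y, y != x.
  by case: (eqVneq u x) uv => [<-|ux] uv; [exists v; rewrite eq_sym | exists u].
have /connectP[[|z p] /= ] := cG x y.
  by move=> _ e; rewrite e eqxx in yx.
by case/andP => xz _ _; exists z.
Qed.

Lemma card_bigcup_leq (I T : finType) (A : {set I}) (F : I -> {set T}) (m : nat) :
  (forall i, i \in A -> #|F i| <= m) -> #|\bigcup_(i in A) F i| <= #|A| * m.
Proof.
move=> Fm; rewrite -sum_nat_const.
elim/big_rec2: _ => [|i n B iA IH]; first by rewrite cards0.
by rewrite (leq_trans (leq_card_setU _ _)) // leq_add // Fm.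
Qed.

(** Take [P] inclusion-maximal among the subsets of [A] with pairwise unrelated points: by
    maximality the sets [[set y | r p y]] with [p] in [P] cover [A]. *)
Lemma packing (T : finType) (r : rel T) (A : {set T}) (b : nat) :
  symmetric r -> reflexive r -> (forall x, #|[set y | r x y]| <= b) ->
  exists P : {set T}, [/\ P \subset A,
    {in P &, forall p q, r p q -> p = q} & #|A| <= #|P| * b].
Proof.
move=> rC rr rb.
pose Q (P : {set T}) :=
  (P \subset A) && [forall p in P, forall q in P, r p q ==> (p == q)].
have QP (P : {set T}) :
    reflect (P \subset A /\ {in P &, forall p q, r p q -> p = q}) (Q P).
  apply: (iffP andP) => -[PA Pr]; split=> //.
    by move=> p q pP qP rpq; have /forall_inP/(_ p pP)/forall_inP/(_ q qP) := Pr;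
      rewrite rpq => /eqP.
  apply/forall_inP => p pP; apply/forall_inP => q qP.
  by apply/implyP => /(Pr p q pP qP) ->.
have Q0 : Q set0 by apply/QP; split=> [|p q]; rewrite ?sub0set ?inE.
have [P /maxsetP[/QP[PA Pr] Pmax] _] := maxset_exists Q0.
exists P; split=> //.
apply: leq_trans (card_bigcup_leq (fun p _ => rb p)).
apply/subset_leq_card/subsetP => x xA; apply: contraT => xP.
have nr p : p \in P -> ~~ r p x.
  by move=> pP; apply: contra xP => rpx; apply/bigcupP; exists p; rewrite ?inE.
suff xPin : x \in P by move: (nr x xPin); rewrite rr.
rewrite -(Pmax (x |: P)) ?setU11 ?subsetUr //; apply/QP; split.
  by rewrite subUset sub1set xA.
move=> p q /setU1P[->|pP] /setU1P[->|qP] //.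
- by rewrite rC (negbTE (nr _ qP)).
- by rewrite (negbTE (nr _ pP)).
- exact: Pr.
Qed.

Definition nbhd (G : sgraph) (A : {set G}) : {set G} :=
  \bigcup_(x in A) (x |: nbrs x).

Lemma card_iter_nbhd (G : sgraph) (k m : nat) (A : {set G}) :
  max_degree G <= m -> #|iter k (@nbhd G) A| <= #|A| * m.+1 ^ k.
Proof.
move=> Gm; elim: k => [|k IH] /=; first by rewrite muln1.
apply: (@leq_trans (#|iter k (@nbhd G) A| * m.+1)).
  apply: card_bigcup_leq => x _.
  by rewrite cardsU1 -add1n leq_add ?leq_b1 // degree_leq.
by rewrite expnS mulnCA mulnC leq_mul.
Qed.

Lemma nbhdP (G : sgraph) (A : {set G}) (y : G) :
  reflect (exists2 x, x \in A & (x == y) || adj x y) (y \in nbhd A).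
Proof.
apply: (iffP bigcupP) => -[x xA xy]; exists x => //.
  by move: xy; rewrite !inE eq_sym.
by rewrite !inE eq_sym.
Qed.

Lemma card_powerset_fiber (I : finType) (Z : {set I}) (F : {set {set I}}) :
  {in F &, forall X Y, X :\: Z = Y :\: Z} -> #|F| <= 2 ^ #|Z|.
Proof.
move=> FZ; rewrite -card_powerset -(@card_in_imset _ _ (fun X => X :&: Z) F).
  by apply/subset_leq_card/subsetP => _ /imsetP[X _ ->]; rewrite inE subsetIr.
by move=> X Y XF YF e; rewrite -(setID X Z) e (FZ X Y) // setID.
Qed.

(** * Blow-ups as maps onto [H]: degrees and arc counts *)

Section BlowupMap.
Variables (H G : sgraph).
Implicit Types (S A B C R : {set G}) (f : G -> H).

Definition blowup_map S f : Prop :=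
  (forall i, exists2 x, x \in S & f x = i) /\
  {in S &, forall x y, adj (f x) (f y) -> adj x y}.

Lemma clique_blowup_map (i0 : H) (U : {set H}) S :
  clique_blowup U (induced S) -> exists f, blowup_map S f.
Proof.
case/existsP => V /and5P[/eqP Vcov /forallP Vn0 Vdis0 /forallP Vadj _].
have Vx (x : induced S) : exists i, x \in V i.
  have : x \in \bigcup_i V i by rewrite Vcov inE.
  by case/bigcupP => i _ ; exists i.
have Vdis i j x : x \in V i -> x \in V j -> i = j.
  move=> xi xj; apply: contraTeq xj => ij.
  have /forallP/(_ j)/implyP/(_ ij) := forallP Vdis0 i.
  by move=> /disjointFr/(_ xi) ->.
(* [i0] is a default value for the vertices outside [S]. *)
pose f (x : G) := if insub x is Some u then xchoose (Vx u) else i0.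
have fP (u : induced S) : u \in V (f (val u)).
  by rewrite /f valK; exact: (xchooseP (Vx u)).
exists f; split=> [i|x y xS yS fxy].
  have /set0Pn[u ui] := Vn0 i; exists (val u); first exact: (valP u).
  exact: Vdis (fP u) ui.
pose u : induced S := Sub x xS; pose v : induced S := Sub y yS.
have /forallP/(_ (f y))/implyP/(_ fxy)/forall_inP/(_ u (fP u)) := Vadj (f x).
by move/forall_inP/(_ v (fP v)).
Qed.

Hypothesis H_nbr : forall i : H, exists j, adj i j.

(** If [j] is a neighbour of [i], any vertex of [S] over [j] is adjacent to the whole fibre over
    [i], so that fibre has at most [m] vertices. *)
Lemma card_fibers S f (m : nat) (L : {set H}) :
  max_degree G <= m -> blowup_map S f ->
  #|[set x in S | f x \in L]| <= #|L| * m.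
Proof.
move=> Gm [fsurj fadj].
apply: leq_trans (@card_bigcup_leq _ _ L (fun i => [set x in S | f x == i]) m _).
  apply/subset_leq_card/subsetP => x; rewrite inE => /andP[xS fxL].
  by apply/bigcupP; exists (f x); rewrite ?inE ?xS ?eqxx.
move=> i _; have [j ij] := H_nbr i; have [y yS fy] := fsurj j.
apply: leq_trans (degree_leq y Gm); apply/subset_leq_card/subsetP => x.
rewrite !inE => /andP[xS /eqP fx]; rewrite adj_sym; apply: fadj => //.
by rewrite fx fy.
Qed.

Lemma blowup_degree S f x : blowup_map S f -> x \in S ->
  degree (f x) <= #|nbrs x :&: S|.
Proof.
move=> [fsurj fadj] xS.
apply: leq_trans (leq_imset_card f _).
apply/subset_leq_card/subsetP => j; rewrite inE => ij.
have [y yS fy] := fsurj j; apply/imsetP; exists y => //.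
by rewrite !inE yS andbT; apply: fadj => //; rewrite fy.
Qed.

(** Equality case of [blowup_degree]: [f] maps the neighbours of [x] in [S] bijectively onto those
    of [f x]. The vertex [z] ranges over all of [S], since [f z] adjacent to [f x] already makes [z]
    a neighbour of [x]. *)
Lemma blowup_degree_eq S f x : blowup_map S f -> x \in S ->
  #|nbrs x :&: S| <= degree (f x) ->
  {in nbrs x :&: S, forall y, adj (f x) (f y)} /\
  {in nbrs x :&: S & S, forall y z, f y = f z -> y = z}.
Proof.
move=> [fsurj fadj] xS deg_x; set M := nbrs x :&: S in deg_x *.
have sub : nbrs (f x) \subset f @: M.
  apply/subsetP => j; rewrite inE => ij; have [y yS fy] := fsurj j.
  by apply/imsetP; exists y => //; rewrite !inE yS andbT; apply: fadj; rewrite ?fy.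
have le_im := leq_imset_card f M.
have imE : nbrs (f x) = f @: M.
  by apply/eqP; rewrite eqEcard sub (leq_trans le_im).
have injf : {in M &, injective f}.
  by apply/imset_injP; rewrite eqn_leq le_im -imE.
have adjf : {in M, forall y, adj (f x) (f y)}.
  by move=> y yM; have := imset_f f yM; rewrite -imE inE.
split=> // y z yM zS fyz; apply: injf => //.
by rewrite !inE zS andbT; apply: fadj => //; rewrite -fyz adjf.
Qed.

(** Ordered pairs are counted, so [arcs S S] is twice the number of edges inside [S]. *)
Definition arcs (A B : {set G}) : nat := \sum_(x in A) #|nbrs x :&: B|.

Lemma arcsC A B : arcs A B = arcs B A.
Proof.
have E (C D : {set G}) : arcs C D = \sum_(x in C) \sum_(y in D) adj x y.
  apply: eq_bigr => x _; rewrite -sum1_card big_mkcond [RHS]big_mkcond /=.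
  by apply: eq_bigr => y _; rewrite !inE; case: (y \in D); case: adj.
rewrite !E exchange_big; apply: eq_bigr => x _; apply: eq_bigr => y _.
by rewrite adj_sym.
Qed.

Lemma arcsUl A B C : [disjoint A & B] -> arcs (A :|: B) C = arcs A C + arcs B C.
Proof. by move=> AB; rewrite /arcs -bigU //; apply: eq_bigl => x; rewrite !inE. Qed.

Lemma arcs_split A R : [disjoint A & R] ->
  arcs (A :|: R) (A :|: R) = arcs A A + 2 * arcs R A + arcs R R.
Proof.
move=> AR; rewrite arcsUl // !(arcsC _ (A :|: R)) !arcsUl // (arcsC A R).
by rewrite mul2n -addnn !addnA.
Qed.

(** Let [A] be the image of a section of [f] and [R] the rest of [S]. Each [x] in [S] has at least
    [degree (f x)] neighbours in [A]; arcs between [R] and [A] count in both directions, and those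
    inside [R] are dropped. *)
Lemma blowup_arcs S f : blowup_map S f ->
  exists R : {set G}, [/\ R \subset S, #|S| = #|H| + #|R| &
    \sum_(i : H) degree i + 2 * \sum_(x in R) degree (f x) <= arcs S S].
Proof.
move=> [fsurj fadj].
have [g gS fg] := fin_all_exists2 fsurj.
have ginj : injective g by exact: can_inj fg.
pose A := [set g i | i : H].
have AS : A \subset S by apply/subsetP => _ /imsetP[i _ ->].
have dAR : [disjoint A & S :\: A] by rewrite -setI_eq0 setDE setICA setICr setI0.
have degA x : x \in S -> degree (f x) <= #|nbrs x :&: A|.
  move=> xS; rewrite /degree -(card_imset _ ginj).
  apply/subset_leq_card/subsetP => _ /imsetP[j + ->]; rewrite inE => ij.
  by rewrite !inE imset_f // andbT; apply: fadj; rewrite ?fg.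
have cA : #|A| = #|H| by rewrite card_imset.
pose R := S :\: A; have RS : R \subset S by exact: subsetDl.
have SE : S = A :|: R by rewrite /R setDE setUIr setUCr setIT (setUidPr AS).
exists R; split=> //.
  by rewrite -cA -[LHS](cardsID A) (setIidPr AS).
rewrite {1 2}SE arcs_split // -addnA leq_add //.
  rewrite /arcs big_imset; last by move=> i j _ _; exact: ginj.
  by apply: leq_sum => i _; rewrite -{1}(fg i) degA.
rewrite (leq_trans _ (leq_addr _ _)) // leq_mul2l /=.
by apply: leq_sum => x xR; rewrite degA // (subsetP RS).
Qed.
End BlowupMap.

(** * The doubling of [H] along [T] *)

Section Doubling.
Variables (H : sgraph) (T : {set H}).

(* The vertices (x, true) with x outside T are isolated, so no blow-up of a
   connected graph uses them. *)
Definition double_adj : rel (H * bool) := fun p q =>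
  adj p.1 q.1 && (if (p.1 \in T) && (q.1 \in T) then p.2 == q.2
                  else ((p.1 \in T) || ~~ p.2) && ((q.1 \in T) || ~~ q.2)).

Fact double_sym : symmetric double_adj.
Proof.
move=> p q; rewrite /double_adj adj_sym [p.2 == _]eq_sym.
by rewrite [(p.1 \in T) && _]andbC [(_ || ~~ p.2) && _]andbC.
Qed.

Fact double_irr : irreflexive double_adj.
Proof. by move=> p; rewrite /double_adj adj_irr. Qed.

Definition doubling : sgraph := SGraph double_sym double_irr.

Lemma doubling_max_degree (m : nat) :
  max_degree H <= m -> max_degree doubling <= m * 2.
Proof.
move=> Hm; apply/bigmax_leqP => z _.
apply: leq_trans (_ : #|setX (nbrs z.1) [set: bool]| <= _).
  by apply/subset_leq_card/subsetP => w; rewrite !inE andbT => /andP[].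
by rewrite cardsX cardsT card_bool leq_mul2r degree_leq.
Qed.

(** Both copies of a vertex [y] can be adjacent to [z] only if [y] lies in [T] and [z.1] does not,
    which the hypothesis excludes. *)
Lemma doubling_fst_inj (z : doubling) :
  (forall y, adj z.1 y -> y \in T -> z.1 \in T) -> {in nbrs z &, injective fst}.
Proof.
move=> zT [y b] [y' c]; rewrite !inE /= /double_adj /=.
case/andP => zy + /andP[_ +] e; rewrite -{}e /=.
case: (boolP (y \in T)) => yT.
  by rewrite (zT y) //= => /eqP <- /eqP <-.
by rewrite andbF /= => /andP[_ /negbTE ->] /andP[_ /negbTE ->].
Qed.

Lemma doubling_degree (z : doubling) :
  (forall y, adj z.1 y -> y \in T -> z.1 \in T) -> #|nbrs z| <= degree z.1.
Proof.
move=> /doubling_fst_inj inj; rewrite -(card_in_imset inj).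
apply/subset_leq_card/subsetP => _ /imsetP[w + ->].
by rewrite !inE => /andP[].
Qed.
End Doubling.

(** * Copies of [H] in the doubling, one choice per gadget *)

Section Gadgets.
Variables (H : sgraph) (P : {set H}) (gadget : H -> {set H}).
Hypothesis gadget_center : {in P, forall p, p \in gadget p}.
Hypothesis gadget_apart : {in P &, forall p q x y,
  x \in gadget p -> y \in gadget q -> (x == y) || adj x y -> p = q}.

Let T := \bigcup_(p in P) gadget p.
Let G := doubling T.

Definition shift (X : {set H}) (x : H) : G := (x, x \in \bigcup_(p in X) gadget p).
Definition copy (X : {set H}) : {set G} := [set shift X x | x : H].

Section OneCopy.
Variable X : {set H}.
Hypothesis XP : X \subset P.

Lemma shift_inj : injective (shift X).
Proof. by move=> x y []. Qed.

Lemma mem_copy z : (z \in copy X) = (z.2 == (z.1 \in \bigcup_(p in X) gadget p)).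
Proof.
apply/imsetP/eqP => [[x _ ->] //|e].
by exists z.1 => //; rewrite /shift -e -surjective_pairing.
Qed.

Lemma shift_gadget p x : p \in P -> x \in gadget p ->
  (x \in \bigcup_(q in X) gadget q) = (p \in X).
Proof.
move=> pP xp; apply/bigcupP/idP => [[q qX xq]|pX]; last by exists p.
by rewrite (gadget_apart pP (subsetP XP q qX) xp xq) ?eqxx.
Qed.

(** Adjacent vertices of [T] lie in the same gadget, hence are taken at the same level. *)
Lemma shift_adj x y : adj (shift X x) (shift X y) = adj x y.
Proof.
rewrite /adj /= /double_adj /=; case xy: (adj x y) => //=.
have okT z : (z \in T) || (z \notin \bigcup_(q in X) gadget q).
  rewrite orbC -implybE; apply/implyP => /bigcupP[q qX zq].
  by apply/bigcupP; exists q; rewrite // (subsetP XP).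
rewrite !okT; case: ifP => // /andP[/bigcupP[p pP xp] /bigcupP[q qP yq]].
have pq : p = q by apply: (gadget_apart pP qP xp yq); rewrite xy orbT.
by rewrite (shift_gadget pP xp) (shift_gadget qP yq) pq eqxx.
Qed.

Lemma copy_blowup (U : {set H}) : clique_blowup U (induced (copy X)).
Proof.
have copyE (s : induced (copy X)) : val s = shift X (val s).1.
  by have /imsetP[x _ ->] := valP s.
have shiftP i : shift X i \in copy X by apply: imset_f.
(* All parts are singletons, so the clique condition holds for every [U]. *)
apply/existsP; exists [ffun i => [set s | (val s).1 == i]].
apply/and5P; split.
- rewrite eqEsubset subsetT; apply/subsetP => s _.
  by apply/bigcupP; exists (val s).1; rewrite ?ffunE ?inE.
- apply/forallP => i; apply/set0Pn; exists (Sub (shift X i) (shiftP i)).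
  by rewrite ffunE inE SubK.
- apply/forallP => i; apply/forallP => j; apply/implyP => ij.
  rewrite !ffunE -setI_eq0; apply/eqP/setP => s; rewrite !inE.
  by apply/negP => /andP[/eqP -> /eqP e]; rewrite e eqxx in ij.
- apply/forallP => i; apply/forallP => j; apply/implyP => ij; rewrite !ffunE.
  apply/forall_inP => s; rewrite inE => /eqP si.
  apply/forall_inP => t; rewrite inE => /eqP tj.
  by rewrite -[adj s t]/(adj (val s) (val t)) (copyE s) (copyE t) shift_adj si tj.
- apply/forall_inP => i _; rewrite ffunE; apply/forall_inP => s; rewrite inE => /eqP si.
  apply/forall_inP => t; rewrite inE => /eqP ti; apply/implyP => /eqP[].
  by apply: val_inj; rewrite (copyE s) (copyE t) si ti.
Qed.

Lemma arcs_copy : arcs (copy X) (copy X) <= \sum_(i : H) degree i.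
Proof.
rewrite {1}/arcs big_imset; last by move=> i j _ _; exact: shift_inj.
apply: leq_sum => i _; rewrite /degree -(card_imset _ shift_inj).
apply/subset_leq_card/subsetP => z; rewrite !inE => /andP[iz /imsetP[j _ zj]].
by rewrite zj imset_f // inE -shift_adj -zj.
Qed.
End OneCopy.

(** Testing the center of a gadget suffices: its level in [copy X] tells whether the gadget belongs
    to [X]. *)
Definition doubled (S : {set G}) : {set H} :=
  [set p in P | ((p, true) \in S) && ((p, false) \in S)].

(** Every [copy X] extends to a maximal blow-up. Two copies inside the same [S] can choose
    differently only at gadgets in [doubled S], so [S] contains at most [2 ^ z] of them. *)
Lemma maximal_blowups_lower_bound (i0 : H) (U : {set H}) (z : nat) :
  (forall (X : {set H}) (S : {set G}) (f : G -> H), X \subset P -> copy X \subset S ->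
     blowup_map S f -> #|doubled S| <= z) ->
  2 ^ #|P| <= #|maximal_blowups U G| * 2 ^ z.
Proof.
move=> dz; rewrite -card_powerset.
pose F (S : {set G}) := [set X in powerset P | copy X \subset S].
apply: leq_trans (_ : #|\bigcup_(S in maximal_blowups U G) F S| <= _).
  apply/subset_leq_card/subsetP => X; rewrite inE => XP.
  have [S Smax XS] :=
    @maxset_exists G (fun S => clique_blowup U (induced S)) _ (copy_blowup XP U).
  by apply/bigcupP; exists S; rewrite !inE ?XP.
apply: card_bigcup_leq => S; rewrite inE => /maxsetp /(clique_blowup_map i0)[f fS].
have [->|/set0Pn[X0]] := eqVneq (F S) set0; first by rewrite cards0.
rewrite !inE => /andP[X0P X0S].
apply: (@leq_trans (2 ^ #|doubled S|)); last first.
  by rewrite leq_exp2l // (dz X0 S f).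
apply: card_powerset_fiber.
have aux (X Y : {set H}) :
    X \subset P -> copy X \subset S -> Y \subset P -> copy Y \subset S ->
    X :\: doubled S \subset Y :\: doubled S.
  move=> XP XS YP YS; apply/subsetP => p /setDP[pX pZ].
  have pP := subsetP XP p pX; have pp := gadget_center pP.
  rewrite inE pZ /=; apply: contraR pZ => pY; rewrite inE pP /=.
  have /(subsetP XS) : shift X p \in copy X by apply: imset_f.
  have /(subsetP YS) : shift Y p \in copy Y by apply: imset_f.
  rewrite /shift (shift_gadget XP pP pp) (shift_gadget YP pP pp) pX (negbTE pY).
  by move=> -> ->.
move=> X Y; rewrite !inE => /andP[XP XS] /andP[YP YS].
by apply/eqP; rewrite eqEsubset !aux.
Qed.

(** * Bounding the doubled gadgets of one blow-up *)

Section Obstruction.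
Variables (delta : nat) (X : {set H}) (S : {set G}) (f : G -> H).
Hypothesis H_nbr : forall i : H, exists j, adj i j.
Hypotheses (XP : X \subset P) (XS : copy X \subset S) (fS : blowup_map S f).

Let low : {set H} := [set i | degree i < delta].
Let D : {set H} := [set i | degree i == delta].
Let lowS : {set G} := [set z in S | f z \in low].

Definition flip (p : H) : G := (p, p \notin X).

Lemma flip_inj : injective flip.
Proof. by move=> p q []. Qed.

Lemma doubled_flip p : p \in doubled S -> flip p \in S.
Proof. by rewrite inE => /and3P[_ pt pf]; rewrite /flip; case: (p \in X). Qed.

Lemma flip_notin_copy p x : p \in P -> x \in gadget p ->
  ((x, p \notin X) : G) \notin copy X.
Proof.
move=> pP xp; rewrite mem_copy /= (shift_gadget XP pP xp).
by case: (p \in X).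
Qed.

Lemma gadget_sub_T p x : p \in P -> x \in gadget p -> x \in T.
Proof. by move=> pP xp; apply/bigcupP; exists p. Qed.

(** Since [H] has no isolated vertex, [z] has a neighbour in [S]. Outside [T], only vertices at
    level [false] have neighbours, and these belong to [copy X]. *)
Lemma residue_T z : z \in S :\: copy X -> z.1 \in T.
Proof.
case/setDP => zS; apply: contraR => zT.
have : 0 < #|nbrs z :&: S|.
  apply: leq_trans (blowup_degree fS zS); have [j ij] := H_nbr (f z).
  by apply/card_gt0P; exists j; rewrite inE.
case/card_gt0P => w; rewrite !inE => /andP[/andP[_ +] _].
rewrite (negbTE zT) /= => /andP[zf _]; rewrite mem_copy (negbTE zf).
case: bigcupP => // -[q qX zq]; case/negP: zT.
exact: gadget_sub_T (subsetP XP q qX) zq.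
Qed.

(** Let [r] be the size of [S :\: copy X]. Beyond the degree sum of [H], [arcs S S] is at least
    [2 * delta * r - 2 * delta * #|lowS|] by [blowup_arcs], and at most [2 * (delta - 1) * r + r] by
    the shape of the gadgets. Hence [r <= 2 * delta * #|lowS|]. *)
Lemma doubled_edge_gadgets :
  {in P, forall p x, x \in gadget p -> degree x = delta /\
     exists2 y, adj x y & gadget p = [set x; y]} ->
  #|doubled S| <= 2 * delta * #|lowS|.
Proof.
move=> gadgetE; set R' := S :\: copy X.
(* If [y] is the partner of [z.1], then [z] misses the copy of [y] in [copy X], and the other copy
   of [y] is its only possible neighbour in [R']. *)
have res z : z \in R' -> #|nbrs z :&: copy X| < delta /\ #|nbrs z :&: R'| <= 1.
  move=> zR; have /bigcupP[p pP zp] := residue_T zR.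
  have [dz [y zy pE]] := gadgetE p pP z.1 zp.
  have yp : y \in gadget p by rewrite pE !inE eqxx orbT.
  have zT := gadget_sub_T pP zp; have yT := gadget_sub_T pP yp.
  have zX : z \notin copy X by case/setDP: zR.
  split.
    rewrite -dz /degree (cardsD1 y) inE zy add1n ltnS.
    rewrite -(@card_in_imset _ _ fst); last first.
      move=> u w; rewrite !inE => /andP[_ +] /andP[_ +].
      by move=> /imsetP[a _ ->] /imsetP[b _ ->] /= ->.
    apply/subset_leq_card/subsetP => _ /imsetP[w + ->].
    rewrite !inE => /andP[/andP[zw /=]] + wX; rewrite zw andbT zT /=.
    case: ifP => [wT /eqP zw2|wT _]; last by apply: contraFneq wT => ->.
    apply: contra zX => /eqP wy; move: wX; rewrite !mem_copy wy zw2.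
    by rewrite (shift_gadget XP pP yp) (shift_gadget XP pP zp).
  rewrite -(cards1 ((y, z.2) : G)); apply/subset_leq_card/subsetP => w.
  case/setIP => + wR; have wT := residue_T wR.
  rewrite !inE => /andP[zw +]; rewrite zT wT /= => /eqP zw2.
  have /bigcupP[q qP wq] := wT.
  have pq : p = q by apply: (gadget_apart pP qP zp wq); rewrite zw orbT.
  move: wq; rewrite -pq pE !inE => /orP[/eqP wz|/eqP wy].
    by move: zw; rewrite wz adj_irr.
  by rewrite [w]surjective_pairing wy zw2.
have [R [RS cS aS]] := blowup_arcs fS.
have SE : S = copy X :|: R'.
  by rewrite /R' setDE setUIr setUCr setIT (setUidPr XS).
have dis : [disjoint copy X & R'] by rewrite -setI_eq0 /R' setDE setICA setICr setI0.
(* [R] comes from a section of [f] and may differ from [R'], but both have [#|S| - #|H|]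
   elements. *)
have cR : #|R| = #|R'|.
  apply/eqP; rewrite -(eqn_add2l #|H|) -cS {1}SE cardsU disjoint_setI0 //.
  by rewrite cards0 subn0 card_imset //; exact: shift_inj.
have dR : #|doubled S| <= #|R'|.
  rewrite -(card_imset _ flip_inj); apply/subset_leq_card/subsetP => _ /imsetP[p pS ->].
  rewrite inE doubled_flip // andbT; move: pS; rewrite inE => /andP[pP _].
  by rewrite flip_notin_copy // gadget_center.
have a1 : arcs R' (copy X) + #|R'| <= delta * #|R'|.
  rewrite mulnC -sum_nat_const -sum1_card -big_split /=.
  by apply: leq_sum => z /res[]; rewrite addn1.
have a2 : arcs R' R' <= #|R'|.
  by rewrite -sum1_card; apply: leq_sum => z /res[].
have low_sum : delta * #|R| <= \sum_(x in R) degree (f x) + delta * #|lowS|.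
  apply: (@leq_trans (\sum_(x in R) degree (f x) + \sum_(x in R) delta * (x \in lowS))).
    rewrite mulnC -sum_nat_const -big_split /=; apply: leq_sum => x xR.
    rewrite !inE (subsetP RS _ xR) /=.
    by case: ltnP => /=; lia.
  rewrite leq_add2l -big_distrr leq_mul2l /=; apply/orP; right.
  rewrite -sum1_card big_mkcond [leqRHS]big_mkcond /=; apply: leq_sum => x _.
  by case: (x \in R); case: (x \in lowS).
have a3 := arcs_copy XP.
have aSE : arcs S S = arcs (copy X) (copy X) + 2 * arcs R' (copy X) + arcs R' R'.
  by rewrite {1 2}SE arcs_split.
nia.
Qed.

Let D' : {set H} := [set x in D | [exists y in D, adj x y]].

(** [f] embeds [M] into [E1], which exceeds [E0] by at most [#|D'| * delta] vertices. But [M :|: B]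
    contains a copy of [E0] and, disjoint from it, the second copy of [v p] for every [p] in [Z2].
    This bounds [Z2]; [Z1] is charged to [lowS]. *)
Lemma doubled_star_gadgets (v : H -> H) :
  {in P, forall p, [/\ p \in D :\: D', adj p (v p) &
     gadget p = v p |: (nbrs (v p) :&: D)]} ->
  #|doubled S| <= #|lowS| + #|lowS| * delta + #|D'| * delta.
Proof.
move=> gadgetE.
have D_nbr x y : x \in D :\: D' -> adj x y -> y \notin D.
  move=> /setDP[xD xD'] xy; apply: contra xD' => yD; rewrite inE xD /=.
  by apply/exists_inP; exists y.
(* Such a [y] is not in [D], so it is some [v p], and the gadget of [p] contains all neighbours of
   [v p] in [D], among them [x]. *)
have D_T x y : x \in D :\: D' -> adj x y -> y \in T -> x \in T.
  move=> xD xy /bigcupP[p pP]; have [_ _ pE] := gadgetE p pP.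
  rewrite pE !inE => /orP[/eqP yv|/andP[_ yD]]; last first.
    by have := D_nbr x y xD xy; rewrite inE yD.
  apply: (gadget_sub_T pP); rewrite pE -yv !inE adj_sym xy.
  by move: xD => /setDP[]; rewrite inE => -> _; rewrite orbT.
have degD (z : G) : z.1 \in D :\: D' -> #|nbrs z| <= delta.
  move=> zD; apply: leq_trans (doubling_degree _) _; first by move=> y; apply: D_T.
  by move: zD => /setDP[]; rewrite inE => /eqP ->.
pose E0 := \bigcup_(x in D :\: D') nbrs x.
pose E1 := \bigcup_(x in D) nbrs x.
have cE1 : #|E1| <= #|E0| + #|D'| * delta.
  apply: (@leq_trans (#|E0| + #|\bigcup_(x in D') nbrs x|)).
    apply: leq_trans (leq_card_setU _ _); apply/subset_leq_card/subsetP => y.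
    case/bigcupP => x xD xy; rewrite inE; case: (boolP (x \in D')) => xD'.
      by apply/orP; right; apply/bigcupP; exists x.
    by apply/orP; left; apply/bigcupP; exists x => //; rewrite inE xD'.
  rewrite leq_add2l; apply: card_bigcup_leq => x; rewrite !inE => /andP[/eqP <- _].
  by [].
pose Y := [set z in S | (z.1 \in D :\: D') && (f z \notin low)].
pose M := \bigcup_(z in Y) (nbrs z :&: S).
(* Here [delta <= degree (f z) <= #|nbrs z :&: S| <= delta], so the equality case [blowup_degree_eq]
   applies. *)
have YP (z : G) : z \in Y -> [/\ z \in S, z.1 \in D :\: D', degree (f z) = delta &
    #|nbrs z :&: S| = delta].
  rewrite inE => /and3P[zS zD]; rewrite inE -leqNgt => fz.
  have le1 := blowup_degree fS zS.
  have le2 : #|nbrs z :&: S| <= delta.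
    by rewrite (leq_trans _ (degD z zD)) // subset_leq_card // subsetIl.
  by split=> //; apply/eqP; rewrite eqn_leq ?fz ?le2 ?(leq_trans le1) ?(leq_trans fz).
have Ynbr (z : G) : z \in Y -> {in nbrs z :&: S, forall y, adj (f z) (f y)} /\
    {in nbrs z :&: S & S, forall y w, f y = f w -> y = w}.
  by move=> /YP[zS _ dz nz]; apply: blowup_degree_eq; rewrite ?dz ?nz.
have cM : #|M| <= #|E1|.
  have injM : {in M &, injective f}.
    move=> y w /bigcupP[z zY yz] /bigcupP[z' _ /setIP[_ wS]].
    by apply: (Ynbr z zY).2.
  rewrite -(card_in_imset injM).
  apply/subset_leq_card/subsetP => _ /imsetP[y /bigcupP[z zY yz] ->].
  have [_ _ dz _] := YP z zY; apply/bigcupP; exists (f z); rewrite inE ?dz //.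
  exact: (Ynbr z zY).1.
(* [B] makes up for the vertices of [E0] whose neighbour in [D :\: D'] is sent by [f] into [low]. *)
pose B := \bigcup_(z in [set z in lowS | z.1 \in D :\: D']) nbrs z.
have cB : #|B| <= #|lowS| * delta.
  apply: (@leq_trans (#|[set z in lowS | z.1 \in D :\: D']| * delta)).
    by apply: card_bigcup_leq => z /setIdP[_]; apply: degD.
  rewrite leq_mul2r subset_leq_card ?orbT //.
  by apply/subsetP => z /setIdP[].
pose Z1 := [set p in doubled S | f (flip p) \in low].
pose Z2 := [set p in doubled S | f (flip p) \notin low].
have cZ : #|doubled S| = #|Z1| + #|Z2|.
  rewrite -(cardsID [set p | f (flip p) \in low] (doubled S)); congr (_ + _).
    by apply: eq_card => p; rewrite !inE.
  by apply: eq_card => p; rewrite !inE andbC.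
have cZ1 : #|Z1| <= #|lowS|.
  rewrite -(card_imset _ flip_inj); apply/subset_leq_card/subsetP => _ /imsetP[p + ->].
  by move=> /setIdP[pS plow]; rewrite inE doubled_flip.
pose vflip p : G := (v p, p \notin X).
have Z2P p : p \in Z2 -> [/\ p \in P, v p \in gadget p & flip p \in Y].
  move=> /setIdP[pS plow]; have pP : p \in P by move: pS; rewrite inE => /andP[].
  have [pD pv pE] := gadgetE p pP; split=> //; first by rewrite pE setU11.
  by apply/setIdP; rewrite doubled_flip // pD plow.
have cZ2 : #|vflip @: Z2| = #|Z2|.
  apply: card_in_imset => p q /Z2P[pP vp _] /Z2P[qP vq _] [e _].
  by apply: (gadget_apart pP qP vp vq); rewrite e eqxx.
(* The [delta] neighbours of [flip p] in [S] project injectively, hence onto [nbrs p]. The one over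
   [v p] must lie at the level of [flip p]. *)
have Z2M : vflip @: Z2 \subset M.
  apply/subsetP => _ /imsetP[p /Z2P[pP vp pY] ->].
  have [pS pD _ nS] := YP _ pY; have [_ pv pE] := gadgetE p pP.
  apply/bigcupP; exists (flip p) => //.
  have sub : fst @: (nbrs (flip p) :&: S) \subset nbrs p.
    by apply/subsetP => _ /imsetP[w + ->]; rewrite !inE => /andP[/andP[]].
  have im : fst @: (nbrs (flip p) :&: S) = nbrs p.
    apply/eqP; rewrite eqEcard sub card_in_imset ?nS; last first.
      have inj : {in nbrs (flip p) &, injective fst}.
        by apply: doubling_fst_inj => y; apply: D_T.
      by move=> u w /setIP[uz _] /setIP[wz _]; apply: inj.
    by move: pD => /setDP[]; rewrite inE => /eqP dp _; rewrite /= -dp.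
  have : v p \in nbrs p by rewrite inE.
  rewrite -im => /imsetP[w wz e]; suff -> : vflip p = w by [].
  move: wz; rewrite !inE => /andP[/andP[_]]; rewrite -e.
  rewrite (gadget_sub_T pP vp) (gadget_sub_T pP (gadget_center pP)) /= => /eqP b _.
  by rewrite [w]surjective_pairing -e -b.
have cover : shift X @: E0 :|: vflip @: Z2 \subset M :|: B.
  rewrite subUset (subset_trans Z2M (subsetUl _ _)) andbT.
  apply/subsetP => _ /imsetP[y /bigcupP[x xD xy] ->].
  have xS z : shift X z \in S by apply: (subsetP XS); apply: imset_f.
  have adj_xy : adj (shift X x) (shift X y) by move: xy; rewrite inE -(shift_adj XP).
  rewrite inE; case: (boolP (f (shift X x) \in low)) => fx; apply/orP; [right|left].
    apply/bigcupP; exists (shift X x); last by rewrite inE.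
    by apply/setIdP; split=> //; apply/setIdP; split.
  apply/bigcupP; exists (shift X x); last by rewrite !inE adj_xy xS.
  by apply/setIdP; rewrite xS xD fx.
have dis : [disjoint shift X @: E0 & vflip @: Z2].
  rewrite -setI_eq0; apply/eqP/setP => z; rewrite !inE.
  apply/negP => /andP[/imsetP[y _ ->] /imsetP[p /Z2P[pP vp _]]] e.
  by have := flip_notin_copy pP vp; rewrite -/(vflip p) -e imset_f.
have := leq_trans (subset_leq_card cover) (leq_card_setU _ _).
rewrite cardsU disjoint_setI0 // cards0 subn0 cZ2 card_imset; last exact: shift_inj.
lia.
Qed.
End Obstruction.
End Gadgets.

(** * Balls, separated gadgets and the choice of [delta] *)

Definition ball (G : sgraph) (k : nat) (x : G) : {set G} := iter k (@nbhd G) [set x].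

Lemma nbhd_iter_mono (G : sgraph) (k : nat) (A B : {set G}) :
  A \subset B -> iter k (@nbhd G) A \subset iter k (@nbhd G) B.
Proof.
move=> AB; elim: k => //= k IH; apply/subsetP => y /nbhdP[x xA xy].
by apply/nbhdP; exists x => //; apply: (subsetP IH).
Qed.

Lemma ball_add (G : sgraph) (k l : nat) (x y z : G) :
  y \in ball k x -> z \in ball l y -> z \in ball (l + k) x.
Proof.
move=> yx; rewrite /ball iterD; apply/subsetP/nbhd_iter_mono.
by rewrite sub1set.
Qed.

Lemma ball1 (G : sgraph) (x y : G) : (y \in ball 1 x) = (x == y) || adj x y.
Proof.
apply/nbhdP/idP => [[z] | xy]; first by rewrite inE => /eqP ->.
by exists x; rewrite ?inE.
Qed.

Lemma ball_sym (G : sgraph) (k : nat) (x y : G) : (y \in ball k x) = (x \in ball k y).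
Proof.
suff imp (u w : G) : w \in ball k u -> u \in ball k w by apply/idP/idP; exact: imp.
elim: k u w => [|k IH] u w; first by rewrite /ball /= !inE eq_sym.
case/nbhdP => z /IH uz zw; rewrite -addn1; apply: ball_add uz.
by rewrite ball1 eq_sym adj_sym.
Qed.

(** The radius is [5 = 2 + 1 + 2]: center to vertex, at most one edge across, vertex to center. *)
Lemma gadget_packing (H : sgraph) (m : nat) (A : {set H}) (gadget : H -> {set H}) :
  max_degree H <= m -> {in A, forall p, gadget p \subset ball 2 p} ->
  exists P : {set H}, [/\ P \subset A,
    {in P &, forall p q x y,
      x \in gadget p -> y \in gadget q -> (x == y) || adj x y -> p = q} &
    #|A| <= #|P| * m.+1 ^ 5].
Proof.
move=> Hm gb.
have [|x||P [PA Papart cA]] := @packing H (fun x y => y \in ball 5 x) A (m.+1 ^ 5).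
- by move=> x y; exact: ball_sym.
- have xx : x \in ball 0 x by rewrite /ball /= inE.
  elim: 5 => // k; rewrite -addn1 addnC => IH; apply: (ball_add IH).
  by rewrite ball1 eqxx.
- move=> x; have := card_iter_nbhd 5 [set x] Hm; rewrite cards1 mul1n.
  by apply: leq_trans; apply/eq_leq/eq_card => y; rewrite inE.
exists P; split=> // p q pP qP x y xp yq xy; apply: Papart => //.
have xp2 := subsetP (gb p (subsetP PA p pP)) x xp.
have yq2 := subsetP (gb q (subsetP PA q qP)) y yq.
rewrite -[5]/(2 + (1 + 2)); apply: (@ball_add _ _ _ _ y); last by rewrite ball_sym.
by apply: ball_add xp2 _; rewrite ball1.
Qed.

(* Take the least delta with at least #|H| / B ^ (d - delta) vertices of degree
   at most delta. *)
Lemma degree_scale (H : sgraph) (d B : nat) :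
  max_degree H <= d -> (forall i : H, exists j, adj i j) -> 0 < #|H| -> 0 < B ->
  exists delta, let low := [set i : H | degree i < delta] in
    let D := [set i : H | degree i == delta] in
    [/\ 0 < delta <= d, B * #|low| <= #|low| + #|D| &
        #|H| <= (#|low| + #|D|) * B ^ d].
Proof.
move=> Hd H_nbr H0 B0; pose L k := #|[set i : H | degree i < k]|.
have LS k : L k.+1 = L k + #|[set i : H | degree i == k]|.
  rewrite /L -[LHS](cardsID [set i : H | degree i < k]); congr (_ + _).
    by apply: eq_card => i; rewrite !inE andbC; case: ltnP => // /ltnW.
  by apply: eq_card => i; rewrite !inE -leqNgt ltnS eqn_leq andbC.
have Q : exists k, #|H| <= L k.+1 * B ^ (d - k).
  exists d; rewrite subnn muln1 -cardsT; apply/subset_leq_card/subsetP => i _.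
  by rewrite inE ltnS degree_leq.
have L1 : L 1 = 0.
  apply: eq_card0 => i; rewrite !inE ltnS leqn0; apply/negP => /eqP i0.
  have [j ij] := H_nbr i; suff : j \in (set0 : {set H}) by rewrite inE.
  by rewrite -(cards0_eq i0) inE.
have kd : ex_minn Q <= d.
  case: ex_minnP => k _ kmin; apply: kmin.
  rewrite subnn muln1 -cardsT; apply/subset_leq_card/subsetP => i _.
  by rewrite inE ltnS degree_leq.
move: kd; case: ex_minnP => -[|k]; first by rewrite L1 mul0n leqNgt H0.
move=> Hk kmin kd; exists k.+1; move=> low D; rewrite -LS kd; split=> //.
  (* By minimality the bound fails one degree lower; comparing the two bounds gives the factor
     [B]. *)
  have := kmin k; rewrite ltnn => /contraNF/(_ isT)/negbT; rewrite -ltnNge.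
  have -> : d - k = (d - k.+1).+1 by lia.
  move=> /(leq_trans)/(_ Hk); rewrite expnS mulnA => /ltnW.
  by rewrite leq_pmul2r ?expn_gt0 ?B0 // mulnC.
by apply: leq_trans Hk _; rewrite leq_mul2l leq_pexp2l ?leq_subr ?orbT.
Qed.

(** * Numerical estimates *)

(** [l], [h], [h'], [p] are the sizes of [low], [D], [D'], [P], and [b] is the packing constant.
    [4 * d ^ 2 * l] bounds [2 * delta * #|lowS|], as [#|lowS| <= 2 * d * l]. *)
Lemma edge_gadget_arith (d b l h h' p : nat) : 0 < d -> 0 < b ->
  64 * d ^ 3 * b ^ 2 * l <= h -> h <= h' * (8 * b * d) -> h' <= p * b ->
  2 * (4 * d ^ 2 * l) <= p /\ l + h <= p * (16 * b ^ 2 * d).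
Proof.
move=> d0 b0; rewrite !(expnS _ 2) -!mulnn => lh hh' h'p.
have hp : h <= p * (8 * (b * b) * d).
  by apply: leq_trans hh' _; apply: leq_trans (leq_mul h'p (leqnn _)) _; lia.
split.
  rewrite -(leq_pmul2r (_ : 0 < 8 * (b * b) * d)) ?muln_gt0 ?b0 ?d0 //.
  by apply: leq_trans hp; apply: leq_trans lh; lia.
have : l <= h by apply: leq_trans lh; rewrite leq_pmull // !muln_gt0 b0 d0.
lia.
Qed.

(** Now [8 * h' <= h], so [p * b] is at least [7/8] of [h] and outweighs the three error terms. *)
Lemma star_gadget_arith (d b l h h' p : nat) : 0 < d -> 0 < b ->
  64 * d ^ 3 * b ^ 2 * l <= h -> h' * (8 * b * d) <= h -> h - h' <= p * b ->
  2 * (2 * d * l + 2 * d * l * d + h' * d) <= p /\ l + h <= p * (16 * b ^ 2 * d).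
Proof.
move=> d0 b0; rewrite !(expnS _ 2) -!mulnn => lh hh' hp.
have bd0 : 0 < b * d by rewrite muln_gt0 b0.
have h8 : 8 * h' <= h.
  by apply: leq_trans hh'; rewrite mulnC leq_mul2l -mulnA leq_pmulr ?orbT.
have l1 : l <= h by apply: leq_trans lh; rewrite leq_pmull // !muln_gt0 b0 d0.
have l2 : 64 * (b * d * d * l) <= h.
  apply: leq_trans lh.
  have -> : 64 * (d * (d * d)) * (b * b) * l = b * d * (64 * (b * d * d * l)) by lia.
  by rewrite leq_pmull.
have l3 : b * d * l <= b * d * d * l by rewrite leq_mul2r leq_pmulr ?orbT.
have l4 : p * b <= p * (b * b * d) by rewrite leq_mul2l -mulnA leq_pmulr ?orbT.
split; last lia.
by rewrite -(leq_pmul2r b0); lia.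
Qed.

Lemma scale_arith (c l h : nat) : 0 < c -> 65 * c * l <= l + h -> 64 * c * l <= h.
Proof. by move=> c0; have : l <= c * l by [rewrite leq_pmull]; lia. Qed.

(** [65 = 64 + 1], because [degree_scale] has [#|low|] on both sides. *)
Definition scale (d : nat) : nat := 65 * d ^ 3 * (d.+1 ^ 5) ^ 2.
(** [32 = 2 * 16]: half of the gadgets may be lost. The last factor comes from [degree_scale]. *)
Definition loss (d : nat) : nat := 32 * (d.+1 ^ 5) ^ 2 * d * scale d ^ d.
(** Bounding constants by powers of [d] and [d.+1] by [d ^ 2] gives [d ^ (30 * d.+1)]; then
    [d <= 2 ^ d] changes the base. *)
Lemma loss_leq (d : nat) : 1 < d -> 2 * loss d <= 2 ^ (d ^ (21 * d + 20)).
Proof.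
move=> d1; have d0 := ltnW d1; have dd : d.+1 <= d ^ 2 by rewrite -mulnn; nia.
have b10 : (d.+1 ^ 5) ^ 2 <= d ^ 20.
  by rewrite -expnM (_ : d ^ 20 = (d ^ 2) ^ 10) ?leq_exp2r // -expnM.
have pow k : 2 ^ k <= d ^ k by case: k => // k; rewrite leq_exp2r.
have scale30 : scale d <= d ^ 30.
  apply: (@leq_trans (d ^ 7 * d ^ 3 * d ^ 20)); last by rewrite -!expnD.
  by apply: leq_mul b10; apply: leq_mul (leqnn _); apply: leq_trans (pow 7).
have loss30 : 2 * loss d <= (d ^ 30) ^ d.+1.
  rewrite expnS mulnA; apply: leq_mul; last by rewrite leq_exp2r.
  apply: (@leq_trans (d ^ 6 * d ^ 20 * d)); last first.
    by rewrite -expnD -expnSr leq_pexp2l.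
  rewrite mulnA (mulnA 2 32); apply: leq_mul (leqnn d); apply: leq_mul b10.
  exact: leq_trans (pow 6).
apply: leq_trans loss30 _; rewrite -expnM.
apply: leq_trans (_ : (2 ^ d) ^ (30 * d.+1) <= _).
  by rewrite leq_exp2r ?muln_gt0 // ltnW // ltn_expl.
rewrite -expnM leq_pexp2l //.
have [e ->] : exists e, 21 * d + 20 = 1 + (5 + 2) + e by exists (21 * d + 12); lia.
rewrite !expnD -[leqLHS]muln1; apply: leq_mul; last by rewrite expn_gt0 d0.
by rewrite leq_mul // leq_mul // (leq_trans _ (pow 5)).
Qed.

(** * Choice of gadgets and conclusion *)

Lemma many_maximal_blowups (H : sgraph) (U : {set H}) (d : nat) :
  connected H -> max_degree H <= d -> 1 < #|H| -> 1 < d ->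
  exists (G : sgraph) (m : nat), [/\ #|G| = #|H| * 2, max_degree G <= d * 2,
    2 ^ m <= #|maximal_blowups U G| & #|H| <= m * loss d].
Proof.
move=> Hc Hd H1 d1; have H_nbr i := connected_nbr i Hc H1.
have [i0 _] : exists i : H, i \in [set: H] by apply/card_gt0P; rewrite cardsT ltnW.
have B0 : 0 < scale d by rewrite /scale !(expn_gt0, muln_gt0) (ltnW d1).
have [delta] := degree_scale Hd H_nbr (ltnW H1) B0.
set low := [set i | _ < _]; set D := [set i | _ == _].
move=> [/andP[delta0 deltad] lowD HD].
pose D' : {set H} := [set x in D | [exists y in D, adj x y]].
have D'D : D' \subset D by apply/subsetP => x /setIdP[].
pose b := d.+1 ^ 5; have b0 : 0 < b by rewrite expn_gt0.
(* Both cases supply separated gadgets of which at most half are doubled in a blow-up, so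
   [m = #|P| - z] is at least half of [#|P|]. *)
suff [P [gadget [z [centers apart bound zP hP]]]] : exists (P : {set H})
    (gadget : H -> {set H}) (z : nat), [/\ {in P, forall p, p \in gadget p},
      {in P &, forall p q x y,
        x \in gadget p -> y \in gadget q -> (x == y) || adj x y -> p = q},
      forall (X : {set H}) (S : {set doubling (\bigcup_(p in P) gadget p)})
          (f : doubling (\bigcup_(p in P) gadget p) -> H), X \subset P ->
        copy P gadget X \subset S -> blowup_map S f -> #|doubled S| <= z,
      2 * z <= #|P| & #|low| + #|D| <= #|P| * (16 * b ^ 2 * d)].
  exists (doubling (\bigcup_(p in P) gadget p)), (#|P| - z); split.
  - by rewrite card_prod card_bool.
  - exact: doubling_max_degree.
  - rewrite -(leq_pmul2r (_ : 0 < 2 ^ z)) ?expn_gt0 // -expnD subnK; last by lia.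
    exact: (maximal_blowups_lower_bound centers apart i0).
  - apply: leq_trans HD _; rewrite /loss mulnA leq_mul2r -/b; apply/orP; right.
    apply: leq_trans hP _.
    apply: (@leq_trans (2 * (#|P| - z) * (16 * b ^ 2 * d))); last by lia.
    by rewrite leq_mul2r; apply/orP; right; lia.
have card_low (T : {set H}) (S : {set doubling T}) f : blowup_map S f ->
    #|[set z in S | f z \in low]| <= #|low| * (d * 2).
  exact: (card_fibers H_nbr low (doubling_max_degree T Hd)).
have lowb : 64 * d ^ 3 * b ^ 2 * #|low| <= #|D|.
  rewrite -(mulnA 64); apply: scale_arith; first by rewrite muln_gt0 !expn_gt0 (ltnW d1).
  by rewrite mulnA; exact: lowD.
have ball2 p q r : adj p q -> q == r \/ adj q r -> r \in @ball H 2 p.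
  move=> pq qr; apply: (@ball_add _ 1 1 _ q); rewrite ball1 ?pq ?orbT //.
  by case: qr => ->; rewrite ?orbT.
(* If [D'] is a fixed fraction of [D], edges inside [D] serve as gadgets; otherwise stars meeting
   [D :\: D'] do. *)
have [cD|cD] := leqP #|D| (#|D'| * (8 * b * d)).
  have partner p : exists y, p \in D' -> y \in D /\ adj p y.
    case: (boolP (p \in D')) => [|_]; last by exists p.
    by case/setIdP => _ /exists_inP[y yD py]; exists y.
  have [v vP] := fin_all_exists partner.
  pose gadget p := [set p; v p].
  have [p pD'|P [PD' apart cP]] := @gadget_packing H d D' gadget Hd.
    have [_ pv] := vP p pD'; apply/subsetP => x /set2P[]->; last first.
      by apply: (ball2 _ _ _ pv); left.
    by apply: (ball2 _ _ _ pv); right; rewrite adj_sym.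
  have dD p : p \in D -> degree p = delta by rewrite inE => /eqP.
  exists P, gadget, (4 * d ^ 2 * #|low|).
  have centers : {in P, forall p, p \in gadget p} by move=> p _; rewrite !inE eqxx.
  split=> //.
  - move=> X S f XP XS fS.
    apply: (@leq_trans (2 * delta * #|[set z in S | f z \in low]|)).
      apply: (@doubled_edge_gadgets _ _ _ centers apart _ X) => //.
      move=> p pP x; have pD' := subsetP PD' p pP; have [vD pv] := vP p pD'.
      have pD := subsetP D'D p pD'; case/set2P=> ->; split; try exact: dD.
        by exists (v p).
      by exists p; [rewrite adj_sym | rewrite /gadget setUC].
    apply: leq_trans (leq_mul (leq_mul (leqnn 2) deltad) (card_low _ S f fS)) _.
    by rewrite -mulnn; lia.
  - exact: (edge_gadget_arith (ltnW d1) b0 lowb cD cP).1.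
  - exact: (edge_gadget_arith (ltnW d1) b0 lowb cD cP).2.
have [v vP] := fin_all_exists H_nbr.
pose gadget p := v p |: (nbrs (v p) :&: D).
have [p pD|P [PD apart cP]] := @gadget_packing H d (D :\: D') gadget Hd.
  apply/subsetP => x /setU1P[->|/setIP[+ _]].
    by apply: (ball2 _ _ _ (vP p)); left.
  by rewrite inE => vx; apply: (ball2 _ _ _ (vP p)); right.
exists P, gadget, (2 * d * #|low| + 2 * d * #|low| * d + #|D'| * d).
have centers : {in P, forall p, p \in gadget p}.
  move=> p /(subsetP PD) /setDP[pD _]; rewrite inE; apply/orP; right.
  by rewrite inE pD inE adj_sym vP.
have cP' : #|D| - #|D'| <= #|P| * b by rewrite -(setIidPr D'D) -cardsD.
split=> //.
- move=> X S f XP XS fS.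
  have lo := card_low _ S f fS.
  apply: leq_trans (@doubled_star_gadgets _ _ _ centers apart delta X S f XP XS fS v _) _.
    by move=> p pP; split=> //; exact: (subsetP PD).
  rewrite leq_add ?leq_mul // (leq_trans (leq_add lo (leq_mul lo deltad))) //; lia.
- exact: (star_gadget_arith (ltnW d1) b0 lowb (ltnW cD) cP').1.
- exact: (star_gadget_arith (ltnW d1) b0 lowb (ltnW cD) cP').2.
Qed.

Theorem theorem11 (R : realType) (d : nat) (hd : 2 <= d)
    (H : sgraph) (Hconn : connected H) (Hdeg : max_degree H = d)
    (N : nat) (HN : #|H| = N) (hN : d ^ (d ^ (d ^ d)) < N)
    (U : {set H}) :
  exists G : sgraph,
    [/\ N <= #|G| <= 2 ^ (d ^ (21 * d + 20)) * N,
        max_degree G <= d * 2 ^ (d ^ (21 * d + 20)) &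
        (2%:R `^ (#|G|%:R / (2 ^ (d ^ (21 * d + 20)))%N%:R)
           <= #|maximal_blowups U G|%:R :> R)%R].
Proof.
have H1 : 1 < #|H| by rewrite HN (leq_trans _ hN) // ltnS expn_gt0 ltnW.
have [G [m [cG dG mG hm]]] := many_maximal_blowups U Hconn (eq_leq Hdeg) H1 hd.
have lossC := loss_leq hd; have d0 : 0 < d by exact: ltnW.
move: (_ ^ (21 * d + 20)) lossC => e lossC.
have C2 : 2 <= 2 ^ e.
  apply: leq_trans lossC; rewrite leq_pmulr //.
  by rewrite /loss /scale !(muln_gt0, expn_gt0) d0.
exists G; rewrite cG -HN; split.
- by rewrite leq_pmulr //= mulnC leq_mul2r C2 orbT.
- by apply: leq_trans dG _; rewrite leq_mul2l C2 orbT.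
(* [#|G| = 2 * #|H| <= m * (2 * loss d) <= m * 2 ^ e], so the real exponent is at most [m]. *)
have GC : #|H| * 2 <= m * 2 ^ e.
  rewrite mulnC (leq_trans (leq_mul (leqnn 2) hm)) // mulnCA leq_mul2l.
  by rewrite lossC orbT.
apply: (@Order.POrderTheory.le_trans _ _ (2%:R `^ m%:R)%R).
  apply: ler_powR; first by rewrite Num.Theory.ler1n.
  rewrite Num.Theory.ler_pdivrMr ?Num.Theory.ltr0n ?expn_gt0 //.
  by rewrite -GRing.Theory.natrM Num.Theory.ler_nat.
by rewrite powR_mulrn ?Num.Theory.ler0n // -GRing.Theory.natrX Num.Theory.ler_nat.
Qed.
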